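(* Let $\mathcal{F} \subset \mathcal{S}(n)$ be a constant coefficient pure second order subequation which is a cone. Then every boundary $\partial\Omega$ of a bounded domain $\Omega \subset \mathbb{R}^n$ with $C^2$ boundary is strictly $\mathcal{F}$-pseudoconvex at every point $x \in \partial\Omega$ if and only if $\mathcal{F}$ is strictly elliptic, i.e. if and only if $$P_e \in \operatorname{Int}\mathcal{F} \quad \text{for every } e \in S^{n-1}.$$
   Context: $\mathcal{S}(n)$ is the space of real symmetric $n\times n$ matrices. A constant coefficient pure second order subequation is a closed set $\mathcal{F} \subset \mathcal{S}(n)$ satisfying: $A \in \mathcal{F}$ and $P \geq 0$ imply $A+P \in \mathcal{F}$. It is a cone if $tA \in \mathcal{F}$ whenever $A \in \mathcal{F}$ and $t > 0$. For a unit vector $e \in S^{n-1}$, $P_e \in \mathcal{S}(n)$ is the orthogonal projection onto the line $\mathbb{R}e$. $\operatorname{Int}$ is the interior in $\mathcal{S}(n)$. Strict pseudoconvexity. For a bounded domain $\Omega$ with $C^2$ boundary and $x \in \partial\Omega$, let $e(x)$ be the inward pointing unit normal at $x$ and let $A_x$ be the second fundamental form of $\partial\Omega$ at $x$ with respect to $e(x)$ (its eigenvalues are the principal curvatures of $\partial\Omega$ at $x$), regarded as an element of $\mathcal{S}(n)$ by extending it by zero in the normal direction $e(x)$. The boundary $\partial\Omega$ is strictly $\mathcal{F}$-pseudoconvex at $x$ if there exists $t_0 > 0$ such that $A_x + tP_{e(x)} \in \operatorname{Int}\mathcal{F}$ for all $t \geq t_0$. *)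

(* Defs.v *)
From HB Require Import structures.
From mathcomp Require Import all_boot all_order all_algebra.
From mathcomp Require Import all_classical all_reals all_analysis.

Set Implicit Arguments.
Unset Strict Implicit.
Unset Printing Implicit Defensive.

Import Order.TTheory GRing.Theory Num.Theory.
Import numFieldNormedType.Exports.

Local Open Scope classical_set_scope.
Local Open Scope ring_scope.

(** Points of [R^n] are column vectors.  The norm [`| _ |] of the library on
    ['cV[R]_n] and ['M[R]_n] is the sup norm: it induces the usual topology and
    the usual bounded sets, but unit length and orthogonality are expressed with
    the Euclidean inner product [dot]. *)
Definition dot (R : realType) (n : nat) (u v : 'cV[R]_n) : R := (u^T *m v) 0 0.

Definition unit_sphere (R : realType) (n : nat) : set 'cV[R]_n :=
  [set e | dot e e = 1].

Definition sym (R : realType) (n : nat) : set 'M[R]_n := [set A | A^T = A].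

Definition psd (R : realType) (n : nat) : set 'M[R]_n :=
  [set P | sym P /\ forall v : 'cV[R]_n, 0 <= dot v (P *m v)].

(** The matrix of the orthogonal projection onto the line spanned by [e], when
    [e] is a unit vector. *)
Definition line_proj (R : realType) (n : nat) (e : 'cV[R]_n) : 'M[R]_n :=
  e *m e^T.

Definition subequation (R : realType) (n : nat) (F : set 'M[R]_n) : Prop :=
  [/\ F `<=` @sym R n,
      closed (F : set (subspace (@sym R n))) &
      forall A P, F A -> psd P -> F (A + P)].

Definition is_cone (R : realType) (n : nat) (F : set 'M[R]_n) : Prop :=
  forall (t : R) A, 0 < t -> F A -> F (t *: A).

(** Interior relative to the space of symmetric matrices (the interior in
    ['M[R]_n] of a set of symmetric matrices would be empty for [n >= 2]). *)
Definition Int (R : realType) (n : nat) (F : set 'M[R]_n) : set 'M[R]_n :=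
  interior (F : set (subspace (@sym R n))).

Definition strictly_elliptic (R : realType) (n : nat) (F : set 'M[R]_n) : Prop :=
  forall e : 'cV[R]_n, unit_sphere e -> Int F (line_proj e).

Definition bounded_domain (R : realType) (n : nat) (Om : set 'cV[R]_n) : Prop :=
  [/\ open Om, connected Om, Om !=set0 & bounded_set Om].

Definition boundary (R : realType) (n : nat) (Om : set 'cV[R]_n) :
    set 'cV[R]_n :=
  closure Om `\` interior Om.

Definition C1_on (R : realType) (n : nat) (U : set 'cV[R]_n)
    (f : 'cV[R]_n -> R) : Prop :=
  forall x, U x ->
    differentiable f x /\ forall v : 'cV[R]_n, {for x, continuous ('D_v f)}.

Definition C2_on (R : realType) (n : nat) (U : set 'cV[R]_n)
    (f : 'cV[R]_n -> R) : Prop :=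
  C1_on U f /\ forall v : 'cV[R]_n, C1_on U ('D_v f).

(** Near each of its boundary points [Om] is the sublevel set [rho < 0] of a
    [C^2] function without critical points; in particular [Om] lies locally on
    one side of its boundary, which is [rho = 0]. *)
Definition C2_boundary (R : realType) (n : nat) (Om : set 'cV[R]_n) : Prop :=
  forall x, boundary Om x ->
    exists (U : set 'cV[R]_n) (rho : 'cV[R]_n -> R),
      [/\ open U, U x, C2_on U rho,
          forall y, U y -> (Om y <-> rho y < 0) &
          forall y, U y -> exists v, 'd rho y v != 0].

(** [v] is the velocity at [x] of a curve drawn on the boundary. *)
Definition tangent (R : realType) (n : nat) (Om : set 'cV[R]_n)
    (x v : 'cV[R]_n) : Prop :=
  exists gamma : R -> 'cV[R]_n,
    [/\ gamma 0 = x, \forall t \near (0 : R), boundary Om (gamma t) &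
        is_derive (0 : R) (1 : R) gamma v].

Definition is_inward_unit_normal (R : realType) (n : nat) (Om : set 'cV[R]_n)
    (x e : 'cV[R]_n) : Prop :=
  [/\ unit_sphere e,
      forall v, tangent Om x v -> dot e v = 0 &
      \forall t \near (0 : R)^'+, Om (x + t *: e)].

(** Weingarten's description of the second fundamental form with respect to the
    inward normal: [A v = - D_v N] for [v] tangent at [x], where [N] is any local
    extension of the inward unit normal field, and [A] kills the normal direction.
    With this sign the curvatures of the boundary of a convex set are
    nonnegative. *)
Definition is_second_fundamental_form (R : realType) (n : nat)
    (Om : set 'cV[R]_n) (x : 'cV[R]_n) (A : 'M[R]_n) : Prop :=
  sym A /\
  exists N : 'cV[R]_n -> 'cV[R]_n,
    [/\ differentiable N x,
        \forall y \near x, boundary Om y -> is_inward_unit_normal Om y (N y),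
        A *m N x = 0 &
        forall v, tangent Om x v -> A *m v = - 'd N x v].

(** When the boundary of [Om] is [C^2] and contains [x], the vector and the matrix
    selected by the next two definitions exist and are unique; the default value
    [0] is then irrelevant. *)
Definition inward_normal (R : realType) (n : nat) (Om : set 'cV[R]_n)
    (x : 'cV[R]_n) : 'cV[R]_n :=
  xget 0 (is_inward_unit_normal Om x).

Definition second_fundamental_form (R : realType) (n : nat)
    (Om : set 'cV[R]_n) (x : 'cV[R]_n) : 'M[R]_n :=
  xget 0 (is_second_fundamental_form Om x).

Definition strictly_pseudoconvex (R : realType) (n : nat) (F : set 'M[R]_n)
    (Om : set 'cV[R]_n) (x : 'cV[R]_n) : Prop :=
  exists2 t0 : R, 0 < t0 &
    forall t : R, t0 <= t ->
      Int F (second_fundamental_form Om x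
             + t *: line_proj (inward_normal Om x)).

(* Main.v *)
Require Import Defs.
From HB Require Import structures.
From mathcomp Require Import all_boot all_order all_algebra.
From mathcomp Require Import all_classical all_reals all_analysis.
From mathcomp Require Import ring lra.
Set Implicit Arguments.
Unset Strict Implicit.
Unset Printing Implicit Defensive.

Import Order.TTheory GRing.Theory Num.Theory.
Import numFieldNormedType.Exports.
Local Open Scope classical_set_scope.
Local Open Scope ring_scope.

(** If [F] is strictly elliptic, then [A_x + t P_e = t (P_e + A_x / t)] is interior
    to [F] for large [t], since the interior of [F] is a cone.
    Conversely, given a unit vector [e], write [b] for the [e]-component of a point
    and [a] for the squared length of its orthogonal part.  The convex domain
    [a ^ 2 + b ^ 2 < 1] is flat to second order at the boundary point [- e], where
    the inward normal is [e].  Hence [t P_e] is interior to [F] for large [t], and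
    so is [P_e]. *)

(** * The Euclidean inner product and projections onto lines *)

Section Dot.
Context {R : realType} {n : nat}.
Implicit Types (u v w e : 'cV[R]_n) (A P : 'M[R]_n).

Lemma dotE u v : dot u v = \sum_i u i 0 * v i 0.
Proof. by rewrite /dot mxE; apply: eq_bigr => i _; rewrite mxE. Qed.

Lemma dotC u v : dot u v = dot v u.
Proof. by rewrite !dotE; apply: eq_bigr => i _; rewrite mulrC. Qed.

Lemma dot_is_linear u : linear (dot u : 'cV[R]_n -> R).
Proof. by move=> a v w; rewrite /dot mulmxDr -scalemxAr !mxE. Qed.

HB.instance Definition _ u :=
  GRing.isLinear.Build R 'cV[R]_n R _ (dot u : 'cV[R]_n -> R) (dot_is_linear u).

Lemma dotDr u v w : dot u (v + w) = dot u v + dot u w.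
Proof. exact: linearD. Qed.

Lemma dotDl u v w : dot (v + w) u = dot v u + dot w u.
Proof. by rewrite !(dotC _ u) dotDr. Qed.

Lemma dotZr a u v : dot u (a *: v) = a * dot u v.
Proof. exact: linearZ. Qed.

Lemma dotZl a u v : dot (a *: u) v = a * dot u v.
Proof. by rewrite dotC dotZr dotC. Qed.

Lemma dotNr u v : dot u (- v) = - dot u v.
Proof. exact: linearN. Qed.

Lemma dotNl u v : dot (- u) v = - dot u v.
Proof. by rewrite dotC dotNr dotC. Qed.

Definition dotBilE := (dotDl, dotDr, dotNl, dotNr, dotZl, dotZr).

Lemma dot_ge0 u : 0 <= dot u u.
Proof. by rewrite dotE sumr_ge0// => i _; rewrite -expr2 sqr_ge0. Qed.

Lemma sqr_coord_le_dot u i : u i 0 ^+ 2 <= dot u u.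
Proof.
rewrite dotE (bigD1 i)//= -expr2 lerDl sumr_ge0// => j _.
by rewrite -expr2 sqr_ge0.
Qed.

Lemma dot_eq0 u : dot u u = 0 -> u = 0.
Proof.
move=> u0; apply/matrixP => i j; rewrite ord1 mxE; apply/eqP.
rewrite -sqrf_eq0 eq_le sqr_ge0 andbT -u0; exact: sqr_coord_le_dot.
Qed.

(** Pythagoras: this identifies the expression [dot x x - dot e x ^+ 2] in [flat_rho] as the squared
    length of the part of [x] orthogonal to [e]. *)
Lemma dot_perp e u : dot e e = 1 ->
  dot (u - dot e u *: e) (u - dot e u *: e) = dot u u - dot e u ^+ 2.
Proof. move=> e1; rewrite !dotBilE e1 (dotC u e); ring. Qed.

Lemma dot_sqr_le e u : dot e e = 1 -> dot e u ^+ 2 <= dot u u.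
Proof. by move=> e1; rewrite -subr_ge0 -dot_perp// dot_ge0. Qed.

Lemma sym_dot A u v : sym A -> dot u (A *m v) = dot (A *m u) v.
Proof. by move=> sA; rewrite /dot trmx_mul sA mulmxA. Qed.

Lemma psd_line_proj e : psd (line_proj e).
Proof.
split; first by rewrite /sym/= /line_proj trmx_mul trmxK.
move=> v; rewrite /line_proj -mulmxA.
have -> : e^T *m v = (dot e v)%:M by rewrite [LHS]mx11_scalar.
by rewrite mul_mx_scalar dotZr (dotC v) -expr2 sqr_ge0.
Qed.

Lemma line_projZ a e : line_proj (a *: e) = a ^+ 2 *: line_proj e.
Proof. by rewrite /line_proj linearZ /= -scalemxAl -scalemxAr scalerA. Qed.

Lemma dot_continuous u : continuous (dot u : 'cV[R]_n -> R).
Proof.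
have -> : dot u = \sum_i (fun v : 'cV[R]_n => u i 0 * v i 0).
  by apply/funext => v; rewrite fct_sumE dotE.
move=> v; apply: differentiable_continuous; apply: differentiable_sum => i.
apply: (@differentiableZ _ _ _ (fun v : 'cV[R]_n => v i 0 : R) (u i 0)).
exact: differentiable_coord.
Qed.

Lemma differentiable_dot u v : differentiable (dot u : 'cV[R]_n -> R) v.
Proof. by apply: linear_differentiable; exact: dot_continuous. Qed.

Lemma diff_dot u v w : 'd (dot u : 'cV[R]_n -> R) v w = dot u w.
Proof.
by rewrite (@diff_lin _ _ _ (dot u : 'cV[R]_n -> R))//; exact: dot_continuous.
Qed.

End Dot.

(** * Smoothness of polynomial functions *)

Section PolynomialFunctions.
Context {R : realType} {n : nat}.

(** These constructors generate a class stable under every ['D_v], so that [C2_on] follows from one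
    induction, without computing a Hessian. *)
Inductive poly_fun : ('cV[R]_n -> R) -> Prop :=
| poly_fun_cst c : poly_fun (cst c)
| poly_fun_dot u : poly_fun (dot u)
| poly_funD f g : poly_fun f -> poly_fun g -> poly_fun (f + g)
| poly_funM f g : poly_fun f -> poly_fun g -> poly_fun (f * g).

Lemma poly_fun_derive f : poly_fun f ->
  (forall x, differentiable f x) /\ forall v, poly_fun ('D_v f).
Proof.
elim=> {f} [c|u|f g pf [df Df] pg [dg Dg]|f g pf [df Df] pg [dg Dg]].
- split=> [x|v]; first exact: differentiable_cst.
  have -> : 'D_v (cst c : 'cV[R]_n -> R) = cst 0; last exact: poly_fun_cst.
  by apply/funext => x; rewrite derive_cst.
- split=> [x|v]; first exact: differentiable_dot.
  have -> : 'D_v (dot u : 'cV[R]_n -> R) = cst (dot u v).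
    apply/funext => x; rewrite deriveE ?diff_dot//; exact: differentiable_dot.
  exact: poly_fun_cst.
- split=> [x|v]; first exact: differentiableD.
  have -> : 'D_v (f + g) = 'D_v f + 'D_v g; last exact: poly_funD.
  by apply/funext => x; rewrite deriveD//; exact: diff_derivable.
- split=> [x|v]; first exact: differentiableM.
  have -> : 'D_v (f * g) = f * 'D_v g + g * 'D_v f.
    by apply/funext => x; rewrite deriveM//; exact: diff_derivable.
  by apply: poly_funD; exact: poly_funM.
Qed.

Lemma poly_fun_differentiable f x : poly_fun f -> differentiable f x.
Proof. by move=> /poly_fun_derive[]. Qed.

Lemma poly_fun_continuous f : poly_fun f -> continuous f.
Proof.
by move=> pf x; apply: differentiable_continuous; exact: poly_fun_differentiable.
Qed.

Lemma poly_fun_C1 U f : poly_fun f -> C1_on U f.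
Proof.
move=> pf x _; split; first exact: poly_fun_differentiable.
by move=> v; apply: poly_fun_continuous; apply: (poly_fun_derive pf).2.
Qed.

Lemma poly_fun_C2 U f : poly_fun f -> C2_on U f.
Proof.
move=> pf; split; first exact: poly_fun_C1.
by move=> v; apply: poly_fun_C1; apply: (poly_fun_derive pf).2.
Qed.

Lemma poly_fun_sqnorm : poly_fun (fun x => dot x x).
Proof.
have -> : (fun x => dot x x) =
    \sum_i (dot (delta_mx i 0) * dot (delta_mx i 0) : 'cV[R]_n -> R).
  apply/funext => x; rewrite fct_sumE dotE; apply: eq_bigr => i _.
  have xi : dot (delta_mx i 0) x = x i 0 by rewrite /dot trmx_delta -rowE mxE.
  by rewrite -xi.
elim/big_ind : _ => [|f g|i _]; [exact: poly_fun_cst|exact: poly_funD|].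
by apply: poly_funM; exact: poly_fun_dot.
Qed.

End PolynomialFunctions.

(** * Derivatives along curves *)

Section Curves.
Context {R : realType} {V W : normedModType R}.

Lemma is_derive_chain (g : R -> V) (f : V -> W) (t : R) (v : V) :
  is_derive t 1 g v -> differentiable f (g t) ->
  is_derive t 1 (f \o g) ('d f (g t) v).
Proof.
move=> [/derivable1_diffP dg <-] df.
have dfg : differentiable (f \o g) t by exact: differentiable_comp.
split; first exact: diff_derivable.
by rewrite !deriveE// diff_comp.
Qed.

Lemma is_derive_continuous (g : R -> V) (t : R) (v : V) :
  is_derive t 1 g v -> {for t, continuous g}.
Proof. by move=> [/derivable1_diffP dg _]; exact: differentiable_continuous. Qed.

Lemma is_derive_scalel (f : R -> R) (t df : R) (v : V) :
  is_derive t 1 f df -> is_derive t 1 (fun s => f s *: v) (df *: v).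
Proof.
move=> [/derivable1_diffP dff <-].
have dfv : differentiable (fun s => f s *: v) t by exact: differentiableZl.
split; first exact: diff_derivable.
by rewrite !deriveE// diffZl.
Qed.

(** Curves in [tangent] are based at time 0; this restarts there a curve whose velocity is known at
    time [t]. *)
Lemma is_derive_translate (g : R -> V) (t : R) (v : V) :
  is_derive t (1 : R) g v -> is_derive (0 : R) (1 : R) (fun s => g (s + t)) v.
Proof.
move=> [dg Dg]; split; move: dg Dg; rewrite /derivable /derive /=.
  by under [X in _ -> _ -> cvg (X @ _)]eq_fun do rewrite addr0 add0r.
by under [X in _ -> _ -> lim (X @ _) = _]eq_fun do rewrite addr0 add0r.
Qed.

End Curves.

(** * Interior relative to the symmetric matrices *)

Section Interior.
Context {R : realType} {n : nat}.
Implicit Types (F : set 'M[R]_n) (A P X : 'M[R]_n).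

(** At a symmetric [X] the relative neighbourhoods come from balls. At any other [X] they are just
    the sets containing [X], so an interior [X] would lie in [F] and be symmetric after all. *)
Lemma IntP F X : F `<=` @sym R n ->
  Int F X <-> sym X /\
    exists2 e : R, 0 < e & forall Y, sym Y -> `|X - Y| < e -> F Y.
Proof.
move=> Fsym; rewrite /Int /interior; rewrite /=.
case: (@nbhs_subspaceP _ (@sym R n) X) => sX.
  split=> [/nbhs_ballP[e e0 eF]|[_ [e e0 eF]]].
    by split=> //; exists e => // Y sY XY; apply: eF => //; rewrite -ball_normE.
  apply/nbhs_ballP; exists e => // Y; rewrite -ball_normE => XY sY.
  exact: eF.
by split=> [/(_ X erefl)/Fsym//|[]].
Qed.

Lemma symD A P : sym A -> sym P -> sym (A + P).
Proof. by move=> sA sP; rewrite /sym/= linearD/= sA sP. Qed.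

Lemma symZ (a : R) A : sym A -> sym (a *: A).
Proof. by move=> sA; rewrite /sym/= linearZ/= sA. Qed.

Lemma symN A : sym A -> sym (- A).
Proof. by move=> sA; rewrite /sym/= linearN/= sA. Qed.

(** Translation by [P] carries a ball around [A] inside [F] to a ball of the same radius around
    [A + P]. *)
Lemma Int_add_psd F A P : subequation F -> Int F A -> psd P -> Int F (A + P).
Proof.
move=> [Fsym _ Fpsd] /(IntP _ Fsym)[sA [e e0 eF]] pP; apply/IntP => //.
split; first by apply: symD => //; case: pP.
exists e => // Y sY AY; rewrite -(subrK P Y); apply: Fpsd => //; apply: eF.
  by apply: symD => //; apply: symN; case: pP.
by rewrite opprB addrA.
Qed.

Lemma Int_scale F A (t : R) : F `<=` @sym R n -> is_cone F ->
  0 < t -> Int F A -> Int F (t *: A).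
Proof.
move=> Fsym Fcone t0 /(IntP _ Fsym)[sA [e e0 eF]]; apply/IntP => //.
split; first exact: symZ.
exists (t * e) => [|Y sY AY]; first exact: mulr_gt0.
have -> : Y = t *: (t^-1 *: Y) by rewrite scalerA divff ?scale1r// gt_eqF.
apply: Fcone => //; apply: eF; first exact: symZ.
have -> : A - t^-1 *: Y = t^-1 *: (t *: A - Y).
  by rewrite scalerBr scalerA mulVf ?scale1r// gt_eqF.
by rewrite normrZ gtr0_norm ?invr_gt0// ltr_pdivrMl.
Qed.

Lemma Int_add_scale F A P : F `<=` @sym R n -> is_cone F -> sym A -> Int F P ->
  exists2 t0 : R, 0 < t0 & forall t, t0 <= t -> Int F (A + t *: P).
Proof.
move=> Fsym Fcone sA /(IntP _ Fsym)[sP [e e0 eF]].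
(* Beyond this bound [A / t] has norm below [e / 2], so the ball of radius [e / 2] around
   [P + A / t] stays within distance [e] of [P]. The [+ 1] keeps the bound positive when [A = 0]. *)
exists (2 * (`|A| + 1) / e).
  by rewrite divr_gt0// mulr_gt0// ltr_wpDl.
move=> t; rewrite ler_pdivrMr// => tA.
have t0 : 0 < t.
  rewrite -(pmulr_lgt0 _ e0); apply: lt_le_trans tA.
  by rewrite mulr_gt0// ltr_wpDl.
have -> : A + t *: P = t *: (P + t^-1 *: A).
  by rewrite scalerDr scalerA divff ?scale1r 1?addrC// gt_eqF.
apply: Int_scale => //; apply/IntP => //; split.
  by apply: symD => //; exact: symZ.
exists (e / 2) => [|Y sY PY]; first by rewrite divr_gt0.
apply: eF => //.
have -> : P - Y = P + t^-1 *: A - Y - t^-1 *: A by rewrite addrAC addrK.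
apply: le_lt_trans (ler_normB _ _) _.
have Ae : `|t^-1 *: A| < e / 2.
  rewrite normrZ gtr0_norm ?invr_gt0// ltr_pdivrMl//.
  have : 0 <= `|A| by [].
  nra.
lra.
Qed.

End Interior.

(** * Defining functions and the inward normal *)

Section InwardNormal.
Context {R : realType} {n : nat}.
Implicit Types (Om U : set 'cV[R]_n) (x v e : 'cV[R]_n).

(** A positive value would keep a neighbourhood of [x] away from [Om], against [x] being in the
    closure; a negative one would make [x] interior. *)
Lemma defining_function_eq0 Om U (rho : 'cV[R]_n -> R) x :
  open U -> (forall y, U y -> {for y, continuous rho}) ->
  (forall y, U y -> (Om y <-> rho y < 0)) ->
  U x -> boundary Om x -> rho x = 0.
Proof.
move=> oU crho OmE Ux [clx nintx]; have nU : nbhs x U by exact: open_nbhs_nbhs.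
apply/eqP; rewrite eq_le; apply/andP; split; rewrite leNgt; apply/negP => rx.
  have rpos : \forall y \near x, 0 < rho y by exact: (cvgr_gt (rho x) (crho x Ux)).
  have [y [Omy [Uy ry]]] := clx _ (filterI nU rpos).
  by have := (OmE y Uy).1 Omy; rewrite ltNge (ltW ry).
have rneg : \forall y \near x, rho y < 0 by exact: (cvgr_lt (rho x) (crho x Ux)).
by apply: nintx; apply: filterS (filterI nU rneg) => y [Uy] /(OmE y Uy).2.
Qed.

(** Riesz representation in coordinates: for the differential of [rho] the column is the
    gradient. *)
Lemma linear_dot (f : {linear 'cV[R]_n -> R}) v :
  f v = dot (\col_i f (delta_mx i 0)) v.
Proof.
rewrite [in LHS](matrix_sum_delta v) linear_sum dotE; apply: eq_bigr => i _.
by rewrite linear_sum big_ord1 linearZ/= mxE mulrC.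
Qed.

(* The inward normal is [- grad rho / |grad rho|]. *)
Lemma inward_unit_normal_exists Om x : C2_boundary Om -> boundary Om x ->
  exists e, is_inward_unit_normal Om x e.
Proof.
move=> C2Om bx; have [U [rho [oU Ux [C1rho _] OmE drho]]] := C2Om x bx.
have crho y : U y -> {for y, continuous rho}.
  by move=> Uy; apply: differentiable_continuous; apply: (C1rho y Uy).1.
have rho0 y : U y -> boundary Om y -> rho y = 0.
  exact: (defining_function_eq0 oU crho OmE).
have drx : differentiable rho x by apply: (C1rho x Ux).1.
have nU : nbhs x U by exact: open_nbhs_nbhs.
pose g : 'cV[R]_n := \col_i 'd rho x (delta_mx i 0).
have gE v : 'd rho x v = dot g v by exact: linear_dot.
have gg0 : 0 < dot g g.
  rewrite lt_neqAle dot_ge0 andbT eq_sym; apply/eqP => /dot_eq0 g0.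
  have [v] := drho x Ux; rewrite gE g0.
  by rewrite dotE big1 ?eqxx// => i _; rewrite mxE mul0r.
pose m := Num.sqrt (dot g g).
have m0 : 0 < m by rewrite sqrtr_gt0.
have mm : dot g g = m ^+ 2 by rewrite sqr_sqrtr// ltW.
pose e := - m^-1 *: g.
have drhoe : 'd rho x e = - m.
  by rewrite gE dotZr mm expr2 mulNr mulKf// gt_eqF.
exists e; split.
- by rewrite /unit_sphere/= !dotBilE mm; field; rewrite gt_eqF.
(* [rho] vanishes along a curve drawn on the boundary, so the gradient is orthogonal to the
   velocity. *)
- move=> v [gam [gam0 bgam dgam]].
  have dgx : differentiable rho (gam 0) by rewrite gam0.
  have := is_derive_chain dgam dgx; rewrite gam0 gE => drg.
  have nUgam : \forall t \near (0 : R), U (gam t).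
    by apply: (is_derive_continuous dgam); rewrite gam0.
  have rg0 : \forall t \near (0 : R), (rho \o gam) t = cst 0 t.
    by apply: filterS2 nUgam bgam => t Ut bt; exact: rho0.
  have := near_eq_is_derive rg0 drg => -[_]; rewrite derive_cst => gv.
  by rewrite dotZl -gv mulr0.
(* The derivative of [rho] along [e] is [- m < 0] and [rho x = 0], so [rho] is negative just after
   [x] in the direction [e]. *)
- have dre : h^-1 *: (rho (h *: e + x) - rho x) @[h --> 0^'] --> - m.
    by rewrite -drhoe -deriveE//; exact: diff_derivable.
  have neg : \forall h \near 0^', h^-1 *: (rho (h *: e + x) - rho x) < 0.
    by apply: (cvgr_lt (- m)) => //; rewrite oppr_lt0.
  have negr : \forall h \near (0 : R)^'+, h^-1 *: (rho (h *: e + x) - rho x) < 0.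
    move: neg; rewrite !near_withinE; apply: filterS => t H t0; apply: H.
    by rewrite gt_eqF.
  have cx : (x + h *: e) @[h --> (0 : R)] --> x.
    rewrite -[X in _ --> X]addr0 -(scale0r e).
    by apply: cvgD; [exact: cvg_cst|apply: cvgZr_tmp; exact: cvg_id].
  near=> t.
  have Ut : U (x + t *: e).
    by near: t; apply: cvg_within; exact: cx.
  have t0 : 0 < t by near: t; exact: nbhs_right_gt.
  apply/(OmE _ Ut).
  have : t^-1 *: (rho (t *: e + x) - rho x) < 0.
    by near: t.
  by rewrite (rho0 x)// subr0 pmulr_rlt0 ?invr_gt0// addrC.
Unshelve. all: by end_near. Qed.

End InwardNormal.

(** * A domain flat to second order at [- e] *)

Section FlatDomain.
Context {R : realType} {n : nat} (e : 'cV[R]_n) (e1 : dot e e = 1).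
Implicit Types (x y v w m : 'cV[R]_n).

Definition flat_rho x : R := (dot x x - dot e x ^+ 2) ^+ 2 + dot e x ^+ 2 - 1.

Definition flat_domain : set 'cV[R]_n := [set x | flat_rho x < 0].

Lemma poly_fun_flat_rho : poly_fun flat_rho.
Proof.
pose p : 'cV[R]_n -> R := (fun x => dot x x) + cst (-1) * (dot e * dot e).
have -> : flat_rho = p * p + dot e * dot e + cst (-1).
  apply/funext => x; rewrite /flat_rho -[RHS]/(p x * p x + dot e x * dot e x - 1).
  rewrite -[p x]/(dot x x + -1 * (dot e x * dot e x)); ring.
have pe : poly_fun (dot e * dot e) by apply: poly_funM; exact: poly_fun_dot.
have pp : poly_fun p.
  by apply: poly_funD poly_fun_sqnorm _; apply: poly_funM (poly_fun_cst _) _.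
apply: poly_funD (poly_fun_cst _); apply: poly_funD pe; exact: poly_funM.
Qed.

Lemma flat_rhoZ (s : R) x : flat_rho (s *: x) =
  s ^+ 4 * (dot x x - dot e x ^+ 2) ^+ 2 + s ^+ 2 * dot e x ^+ 2 - 1.
Proof. rewrite /flat_rho !dotBilE; ring. Qed.

(** The bound is independent of [x] and negative for [s < 1]. It thus gives star-shapedness and also
    shows that zeros of [flat_rho] are limits of points of the domain. *)
Lemma flat_rhoZ_le (s : R) x : 0 <= s <= 1 -> flat_rho x <= 0 ->
  flat_rho (s *: x) <= s ^+ 2 - 1.
Proof.
move=> /andP[s0 s1]; rewrite flat_rhoZ /flat_rho => rx.
set a : R := (_ - _) ^+ 2 in rx *; set b : R := dot e x ^+ 2 in rx *.
have a0 : 0 <= a by exact: sqr_ge0.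
have s21 : s ^+ 2 <= 1 by rewrite expr_le1.
have s20 : 0 <= s ^+ 2 by exact: sqr_ge0.
(* The quantities in [h1] and [h2] add up to the difference of the two sides. *)
have h1 : 0 <= s ^+ 2 * (1 - s ^+ 2) * a.
  by do 2?apply: mulr_ge0 => //; rewrite subr_ge0.
have h2 : 0 <= s ^+ 2 * (1 - a - b) by rewrite mulr_ge0//; lra.
rewrite -subr_ge0.
apply: le_trans (addr_ge0 h1 h2) _.
by rewrite le_eqVlt; apply/orP; left; apply/eqP; ring.
Qed.

Lemma flat_domain_star (s : R) x :
  0 <= s <= 1 -> flat_domain x -> flat_domain (s *: x).
Proof.
move=> s01 rx; have [->|s1] := eqVneq s 1; first by rewrite scale1r.
have := flat_rhoZ_le s01 (ltW rx); rewrite /flat_domain/= => /le_lt_trans; apply.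
case/andP: s01 => s0 s1'; rewrite subr_lt0 expr_lt1// lt_neqAle s1.
by rewrite s1'.
Qed.

Lemma flat_domain0 : flat_domain 0.
Proof.
by rewrite /flat_domain/= -(scale0r e) flat_rhoZ !expr0n/= !mul0r add0r sub0r oppr_lt0.
Qed.

Lemma flat_domain_open : open flat_domain.
Proof.
have -> : flat_domain = flat_rho @^-1` [set r | r < 0] by [].
apply: open_comp; last exact: open_lt.
by move=> x _; apply: poly_fun_continuous; exact: poly_fun_flat_rho.
Qed.

Lemma flat_domain_connected : connected flat_domain.
Proof.
(* The domain is the union of the segments joining 0 to its points, all of which share 0. *)
have -> : flat_domain =
    \bigcup_(x in flat_domain) ((fun s : R => s *: x) @` `[0, 1]%classic).
  apply/seteqP; split=> [x Dx|_ [x Dx [s s01 <-]]].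
    by exists x => //; exists 1; rewrite ?scale1r//= in_itv/= ler01 lexx.
  by apply: flat_domain_star => //; move: s01; rewrite /= in_itv.
apply: bigcup_connected => [|x _].
  by exists 0 => x _; exists 0; rewrite ?scale0r//= in_itv/= ler01 lexx.
apply: connected_continuous_connected; first exact: segment_connected.
by apply: continuous_subspaceT; exact: scalel_continuous.
Qed.

Lemma flat_domain_bounded : bounded_set flat_domain.
Proof.
(* The orthogonal part and the [e]-component both have squared length at most 1, so every squared
   coordinate is at most [2 <= 2 ^ 2]. *)
exists 2; split=> // M M2 x; rewrite /flat_domain/= /flat_rho => rx.
apply: le_trans (ltW M2).
have dx : dot x x <= 2.
  have := sqr_ge0 (dot e x); have := sqr_ge0 (dot x x - dot e x ^+ 2).
  have := dot_sqr_le x e1; nra.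
rewrite /Num.norm/= mx_normrE; apply/bigmax_leP; split=> // -[i j] _ /=.
have := sqr_coord_le_dot x i; rewrite (ord1 j) => xi.
rewrite -(@ler_pXn2r _ 2)// ?nnegrE// real_normK ?num_real//.
by rewrite (le_trans xi)// (le_trans dx)//; lra.
Qed.

Lemma bounded_domain_flat : bounded_domain flat_domain.
Proof.
split; [exact: flat_domain_open|exact: flat_domain_connected|
  by exists 0; exact: flat_domain0|exact: flat_domain_bounded].
Qed.

Lemma boundary_flat_domain x : boundary flat_domain x <-> flat_rho x = 0.
Proof.
split=> [|rx].
  apply: (@defining_function_eq0 _ _ _ setT) => //; first exact: openT.
  by move=> y _; apply: poly_fun_continuous; exact: poly_fun_flat_rho.
split; last by move=> /interior_subset; rewrite /flat_domain/= rx ltxx.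
move=> B Bx.
(* The points [(1 - h) x] with small [h > 0] lie in the domain and tend to [x]. *)
have cx : ((1 - h) *: x) @[h --> (0 : R)^'+] --> x.
  have -> : nbhs x = nbhs ((1 - 0 : R) *: x) by rewrite subr0 scale1r.
  apply: cvgZr_tmp; apply: cvgB; first exact: cvg_cst.
  by apply: cvg_within_filter; exact: cvg_id.
near (0 : R)^'+ => h.
exists ((1 - h) *: x); split; last by near: h; exact: cx.
have h0 : 0 < h by near: h; exact: nbhs_right_gt.
have h1 : h < 1 by near: h; exact: nbhs_right_lt.
have := @flat_rhoZ_le (1 - h) x; rewrite rx lexx => /(_ _ isT) H.
rewrite /flat_domain/=; apply: le_lt_trans (H _) _; first by lra.
nra.
Unshelve. all: by end_near. Qed.

(* The derivative of [flat_rho] at [y] in the direction [y] is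
   [4 (dot y y - dot e y ^ 2) ^ 2 + 2 dot e y ^ 2], at least [2 (flat_rho y + 1)]. *)
Lemma C2_boundary_flat : C2_boundary flat_domain.
Proof.
move=> x /boundary_flat_domain rx.
(* This neighbourhood leaves out the origin, where [flat_rho] attains its minimum [- 1] and is
   critical. *)
exists [set y | -1 < flat_rho y], flat_rho; split.
- have -> : [set y | -1 < flat_rho y] = flat_rho @^-1` [set r | -1 < r] by [].
  apply: open_comp; last exact: open_gt.
  by move=> y _; apply: poly_fun_continuous; exact: poly_fun_flat_rho.
- by rewrite /= rx oppr_lt0.
- exact: poly_fun_C2 poly_fun_flat_rho.
- by [].
- move=> y /= ry; exists y.
  have d1 : is_derive (1 : R) 1 (fun s : R => s *: y) (1 *: y).
    exact: is_derive_scalel.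
  have := is_derive_chain d1 (poly_fun_differentiable _ poly_fun_flat_rho).
  rewrite scale1r => -[_ <-].
  set a := (dot y y - dot e y ^+ 2) ^+ 2; set b := dot e y ^+ 2.
  pose p : {poly R} := a *: 'X^4 + b *: 'X^2 - 1%:P.
  have -> : flat_rho \o (fun s => s *: y) = horner p.
    apply/funext => s; rewrite /= flat_rhoZ -/a -/b.
    by rewrite /p !(hornerD, hornerN, hornerZ, hornerC, hornerXn); ring.
  have [_ ->] := is_derive_poly p 1.
  rewrite /p !(derivD, derivN, derivZ, derivC, derivXn).
  rewrite !(hornerD, hornerN, hornerZ, hornerC, hornerXn, hornerMn, expr1n).
  move: ry; rewrite /flat_rho -/a -/b => ry.
  have a0 : 0 <= a by exact: sqr_ge0.
  have b0 : 0 <= b by exact: sqr_ge0.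
  by rewrite gt_eqF//; lra.
Qed.

(** * Boundary curves through [- e] and the normal along them *)

Section FlatPoint.
Context (v : 'cV[R]_n) (ev : dot e v = 0).

(** The curve [g] leaves [- e] with velocity [v]. Its orthogonal part [t v] has squared length
    [t ^ 2 * dot v v], so [f] is chosen to solve [c t ^ 4 + f ^ 2 = 1], which keeps [g] on the
    boundary. *)
Let c : R := dot v v ^+ 2.
Let q : {poly R} := 1%:P - c *: 'X^4.
Let f (t : R) : R := Num.sqrt q.[t].
Let g (t : R) : 'cV[R]_n := t *: v - f t *: e.

Let qE t : q.[t] = 1 - c * t ^+ 4.
Proof. by rewrite /q !(hornerD, hornerN, hornerZ, hornerC, hornerXn). Qed.

Let f0 : f 0 = 1.
Proof. by rewrite /f qE expr0n mulr0 subr0 sqrtr1. Qed.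

Let q_gt0_near (t : R) : 0 < q.[t] -> \forall s \near t, 0 < q.[s].
Proof. by move=> qt; exact: (cvgr_gt q.[t] (@continuous_horner _ q t)). Qed.

Let q_gt0_near0 : \forall t \near (0 : R), 0 < q.[t].
Proof. by apply: q_gt0_near; rewrite qE expr0n mulr0 subr0. Qed.

Let is_derive_f (t : R) : 0 < q.[t] ->
  is_derive t 1 f ((2 * f t)^-1 * - (4 * c * t ^+ 3)).
Proof.
move=> qt; have <- : q^`().[t] = - (4 * c * t ^+ 3).
  rewrite /q !(derivD, derivN, derivZ, derivC, derivXn).
  by rewrite !(hornerD, hornerN, hornerZ, hornerC, hornerXn, hornerMn); ring.
exact: is_derive1_comp (is_derive1_sqrt qt) (is_derive_poly q t).
Qed.

Let is_derive_g (t : R) : 0 < q.[t] ->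
  is_derive t (1 : R) g (v - ((2 * f t)^-1 * - (4 * c * t ^+ 3)) *: e).
Proof.
move=> qt; have d1 := is_derive_scalel v (is_derive_id t (1 : R)).
rewrite -[X in X - _]scale1r; apply: is_deriveB d1 _.
exact: is_derive_scalel (is_derive_f qt).
Qed.

Let boundary_g (t : R) : 0 < q.[t] -> boundary flat_domain (g t).
Proof.
move=> qt; apply/boundary_flat_domain.
have ff : f t ^+ 2 = 1 - c * t ^+ 4 by rewrite sqr_sqrtr ?qE// -qE ltW.
have -> : flat_rho (g t) = t ^+ 4 * c + f t ^+ 2 - 1.
  by rewrite /flat_rho !dotBilE ev e1 (dotC v e) ev /c; ring.
by rewrite ff; ring.
Qed.

(** Tangency at all nearby points of the curve, beyond [- e] itself, is what allows the
    orthogonality relation for [N] to be differentiated. *)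
Let tangent_g (t : R) : 0 < q.[t] ->
  tangent flat_domain (g t) (v - ((2 * f t)^-1 * - (4 * c * t ^+ 3)) *: e).
Proof.
move=> qt; exists (fun s => g (s + t)); split.
- by rewrite add0r.
- have ct : (s + t) @[s --> (0 : R)] --> t.
    have -> : nbhs t = nbhs (0 + t) by rewrite add0r.
    by apply: cvgD; [exact: cvg_id|exact: cvg_cst].
  have : \forall s \near (0 : R), 0 < q.[s + t] by exact: ct _ (q_gt0_near qt).
  by apply: filterS => s; exact: boundary_g.
- exact: is_derive_translate (is_derive_g qt).
Qed.

Let g0 : g 0 = - e.
Proof. by rewrite /g f0 scale0r scale1r add0r. Qed.

Lemma tangent_flat_point : tangent flat_domain (- e) v.
Proof.
have := tangent_g (nbhs_singleton q_gt0_near0).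
by rewrite g0 expr0n !mulr0 oppr0 mulr0 scale0r subr0.
Qed.

(* On the curve [g t = t v - f t e] drawn on the boundary, [N] is orthogonal to
   [v - f' t e], so that [f t * dot v (N (g t)) = - 2 c t ^ 3 * dot e (N (g t))]
   vanishes to second order at [t = 0]. *)
Lemma flat_point_normal_derivative (N : 'cV[R]_n -> 'cV[R]_n) :
  differentiable N (- e) ->
  (\forall y \near - e, boundary flat_domain y ->
     is_inward_unit_normal flat_domain y (N y)) ->
  dot v ('d N (- e) v) = 0.
Proof.
move=> dN nN; have q0 := nbhs_singleton q_gt0_near0.
have dg : is_derive (0 : R) (1 : R) g v.
  have := is_derive_g q0.
  by rewrite expr0n !mulr0 oppr0 mulr0 scale0r subr0.
have dNg : is_derive (0 : R) (1 : R) (N \o g) ('d N (- e) v).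
  by have := @is_derive_chain _ _ _ _ N _ _ dg; rewrite g0; exact.
have dphi u : is_derive (0 : R) (1 : R) (fun t => dot u (N (g t)))
    (dot u ('d N (- e) v)).
  rewrite -(diff_dot u (N (g 0))).
  exact: (is_derive_chain dNg (differentiable_dot _ _)).
have df : is_derive (0 : R) (1 : R) f 0.
  by have := is_derive_f q0; rewrite expr0n !mulr0 oppr0 mulr0.
have orth : \forall t \near (0 : R),
    f t * dot v (N (g t)) = (- 2 * c * t ^+ 3) * dot e (N (g t)).
  have cg : g t @[t --> (0 : R)] --> - e.
    by rewrite -g0; exact: is_derive_continuous dg.
  apply: filterS2 q_gt0_near0 (cg _ nN) => t qt.
  move=> /(_ (boundary_g qt))[_ /(_ _ (tangent_g qt)) + _].
  have ft : f t != 0 by rewrite gt_eqF// sqrtr_gt0.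
  rewrite dotDr dotNr dotZr !(dotC (N _)) => /eqP; rewrite subr_eq0 => /eqP ->.
  by field.
pose p : {poly R} := (- 2 * c) *: 'X^3.
(* Both sides of [orth] are differentiated at 0. On the left only [f 0 * dot v ('d N (- e) v)]
   survives, as [f] has derivative 0; on the right nothing does, as [p] and its derivative
   vanish. *)
have [_ D1] := near_eq_is_derive orth (is_deriveM df (dphi v)).
have [_ D2] := is_deriveM (is_derive_poly p 0) (dphi e).
have p0 : p.[0] = 0 by rewrite hornerZ hornerXn expr0n mulr0.
have dp0 : p^`().[0] = 0.
  by rewrite derivZ derivXn hornerZ hornerMn hornerXn expr0n mul0rn mulr0.
move: D2; rewrite p0 dp0 scale0r scaler0 addr0.
have -> : horner p * (fun t => dot e (N (g t))) =
    (fun t => (- 2 * c * t ^+ 3) * dot e (N (g t))).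
  by apply/funext => t; rewrite -[LHS]/(p.[t] * _) hornerZ hornerXn.
rewrite D1 scaler0 addr0 f0 scale1r; exact.
Qed.

End FlatPoint.

(** The part of [m] orthogonal to [e] is tangent at [- e], hence orthogonal to [m], hence zero. This
    fixes [m] up to sign, and [line_proj] takes the same value at [e] and [- e]. *)
Lemma flat_point_inward_normal m :
  is_inward_unit_normal flat_domain (- e) m ->
  m = dot e m *: e /\ dot e m ^+ 2 = 1.
Proof.
move=> [m1 mtan _]; pose v := m - dot e m *: e.
have ev : dot e v = 0 by rewrite !dotBilE e1 mulr1 subrr.
have vv : dot v v = 1 - dot e m ^+ 2 by rewrite dot_perp// m1.
have : dot m v = 0 by apply: mtan; exact: tangent_flat_point.
rewrite !dotBilE m1 (dotC m) -expr2 => em; split; last by lra.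
by apply/eqP; rewrite -subr_eq0; apply/eqP/dot_eq0; rewrite -/v vv.
Qed.

Lemma flat_point_boundary : boundary flat_domain (- e).
Proof. by apply/boundary_flat_domain; rewrite /flat_rho !dotBilE e1; ring. Qed.

(* The second fundamental form is in fact [0] at [- e]. *)
Lemma flat_point_second_fundamental_form A :
  is_second_fundamental_form flat_domain (- e) A -> psd (- A).
Proof.
move=> [sA [N [dN nN AN AT]]]; split; first exact: symN.
have [Ne a1] := flat_point_inward_normal (nbhs_singleton nN flat_point_boundary).
have Ae : A *m e = 0.
  have a0 : dot e (N (- e)) != 0.
    by apply/eqP => a0; move: a1; rewrite a0 expr0n => /eqP; rewrite eq_sym oner_eq0.
  move: AN; rewrite Ne -scalemxAr => /eqP; rewrite scaler_eq0 (negbTE a0) /=.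
  by move/eqP.
(* Since [A] is symmetric and kills [e], its quadratic form at [w] equals that at the tangential
   part [v], which the Weingarten relation turns into the vanishing [- dot v ('d N (- e) v)]. *)
move=> w; pose v := w - dot e w *: e.
have ev : dot e v = 0 by rewrite !dotBilE e1 mulr1 subrr.
have wE : w = v + dot e w *: e by rewrite subrK.
have Aw : A *m w = A *m v.
  by rewrite [in LHS]wE mulmxDr -scalemxAr Ae scaler0 addr0.
rewrite mulNmx dotNr Aw sym_dot// Aw -sym_dot//.
rewrite AT; last exact: tangent_flat_point.
by rewrite dotNr opprK flat_point_normal_derivative.
Qed.

End FlatDomain.

(** * The two implications *)

Theorem mainTheorem2 (R : realType) (n : nat) (F : set 'M[R]_n)
    (F_subequation : subequation F) (F_cone : is_cone F) :
  (forall Om : set 'cV[R]_n, bounded_domain Om -> C2_boundary Om ->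
     forall x : 'cV[R]_n, boundary Om x -> strictly_pseudoconvex F Om x)
  <-> strictly_elliptic F.
Proof.
have [Fsym _ _] := F_subequation; split=> [Fconv e e1|Fell Om _ C2Om x bx].
  pose D := flat_domain e; pose A := second_fundamental_form D (- e).
  have bD : boundary D (- e) by exact: flat_point_boundary.
  have C2D : C2_boundary D by exact: C2_boundary_flat.
  have [t0 t0_gt0] := Fconv D (bounded_domain_flat e1) C2D _ bD.
  move=> /(_ t0 (lexx _)); rewrite -/A => FA.
  have pA : psd (- A).
    rewrite /A /second_fundamental_form; case: xgetP => [B _|_].
      exact: flat_point_second_fundamental_form.
    (* Here [A] is the default value 0 of [xget], whose opposite is positive semidefinite as
       well. *)
    by rewrite oppr0; split=> [|v]; rewrite /sym/= ?linear0// mul0mx linear0.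
  have nD : is_inward_unit_normal D (- e) (inward_normal D (- e)).
    exact: xgetPex (inward_unit_normal_exists C2D bD).
  have [nE n1] := flat_point_inward_normal e1 nD.
  (* Adding [- A] cancels the curvature term and leaves [t0] times the projection onto [e]; the cone
     property then removes [t0]. *)
  have := Int_add_psd F_subequation FA pA.
  rewrite addrAC subrr add0r nE line_projZ n1 scale1r => Ft0.
  rewrite -[line_proj e]scale1r -(mulVf (lt0r_neq0 t0_gt0)) -scalerA.
  by apply: Int_scale; rewrite ?invr_gt0.
have [n1 _ _] : is_inward_unit_normal Om x (inward_normal Om x).
  exact: xgetPex (inward_unit_normal_exists C2Om bx).
apply: Int_add_scale => //; last exact: Fell.
(* Only symmetry of the selected matrix remains to be shown; the default value 0 has it too. *)
rewrite /second_fundamental_form; case: xgetP => [B _ []//|_].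
by rewrite /sym/= linear0.
Qed.
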